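(* For every integer $d\ge 1$ and every convex and compact set $K\subset\mathbb R_+^d$, there exists a subset $A\subset K$ with at most $2^{8d}$ elements that is a $32$-ratio cover of $K$.
   Context: $\mathbb R_+=[0,\infty)$. For a compact set $K\subset\mathbb R_+^d$ and $\alpha\ge 1$, a subset $A\subset K$ is an $\alpha$-ratio cover of $K$ if for every $\theta=(\theta_1,\dots,\theta_d)\in K$ there exists $\phi=(\phi_1,\dots,\phi_d)\in A$ such that $\theta_j\le\alpha\,\phi_j$ for every $j=1,\dots,d$. *)

(* Defs.v *)
From mathcomp Require Import all_boot all_order all_algebra.
From mathcomp Require Import all_classical all_reals topology normedtype convex.

Set Implicit Arguments.
Unset Strict Implicit.
Unset Printing Implicit Defensive.

Import Order.TTheory GRing.Theory Num.Theory.
Import numFieldNormedType.Exports.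

Local Open Scope classical_set_scope.
Local Open Scope ring_scope.

Definition nonneg_orthant (R : realType) (d : nat) : set 'rV[R]_d :=
  [set x | forall j : 'I_d, 0 <= x ord0 j].
Arguments nonneg_orthant : clear implicits.

(* The notion is used for alpha >= 1 and K a compact subset of the nonnegative
   orthant; those standing assumptions are not part of the predicate. *)
Definition ratio_cover (R : realType) (d : nat) (alpha : R)
    (K A : set 'rV[R]_d) : Prop :=
  A `<=` K /\
  forall theta, K theta ->
    exists2 phi, A phi &
      forall j : 'I_d, theta ord0 j <= alpha * phi ord0 j.

(* Main.v *)
Require Import Defs.
From mathcomp Require Import all_boot all_order all_algebra.
From mathcomp Require Import all_classical all_reals topology normedtype convex.
From mathcomp Require Import interval_inference derive ring lra.
Import Order.TTheory GRing.Theory Num.Theory.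
Import numFieldNormedType.Exports.
Local Open Scope classical_set_scope.
Local Open Scope card_scope.
Local Open Scope ring_scope.

(** Let phi maximize the product of the coordinates over K, coordinates that
    vanish identically on K being left out. Comparing phi with the midpoint of
    phi and theta gives \prod_j (1 + theta_j / phi_j) <= 2 ^ d for theta in K.
    Hence k_j := floor (log_2 (1 + theta_j / phi_j)) satisfies
    \sum_j k_j <= d, so that theta |-> k takes at most 'C(2d, d) <= 2 ^ (2d)
    values. If theta and theta' have the same k then
    phi_j + theta_j <= 2 (phi_j + theta'_j) for all j; so the midpoints of phi
    with one representative of each class form a 4-ratio cover. *)

Definition floor_log2 {R : realType} (x : R) : nat :=
  trunc_log 2 (Num.truncn x).

(** Powers of 2 are integers, so they compare with [x] as they do with its integer part, which is
    positive because [1 <= x]. *)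
Lemma floor_log2_bounds {R : realType} {x : R} : 1 <= x ->
  2 ^+ floor_log2 x <= x < 2 ^+ (floor_log2 x).+1.
Proof.
move=> x1; have x0 : 0 <= x by apply: le_trans x1.
have t0 : (0 < Num.truncn x)%N by rewrite truncn_gt0.
have /andP[le1 lt2] := trunc_log_bounds (isT : (1 < 2)%N) t0.
have /andP[tx xt] := truncn_itv x0.
rewrite -!natrX; apply/andP; split.
  by apply: le_trans tx; rewrite ler_nat.
by apply: lt_le_trans xt _; rewrite ler_nat.
Qed.

Lemma midpoint_mem {R : realType} {V : lmodType R} {K : set V} {x y : V} :
  convex_set (K : set (convex_lmodType V)) -> K x -> K y ->
  K (2^-1 *: (x + y)).
Proof.
move=> cK Kx Ky.
have h0 : 0 <= 2^-1 :> R by lra.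
have h1 : 2^-1 <= 1 :> R by lra.
have /set_mem := cK x y (Itv01 h0 h1) (mem_set Kx) (mem_set Ky).
rewrite /conv /= /unstable.onem scalerDr.
by rewrite (_ : 1 - 2^-1 = 2^-1 :> R) //; lra.
Qed.

Section NonnegativeConvex.
Context {R : realType} {d : nat} {K : set 'rV[R]_d}.
Hypothesis K_nonneg : K `<=` nonneg_orthant R d.
Hypothesis K_convex : convex_set (K : set (convex_lmodType 'rV[R]_d)).

(** Induction over the coordinates: averaging with a point that is positive at a new coordinate
    keeps, by nonnegativity, the positivity already gained. *)
Lemma exists_common_positive : K !=set0 ->
  exists2 x, K x & forall (y : 'rV[R]_d) j, K y -> 0 < y ord0 j -> 0 < x ord0 j.
Proof.
move=> [x0 Kx0].
suff [x Kx xP] : exists2 x, K x & forall (y : 'rV[R]_d) j,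
    j \in enum 'I_d -> K y -> 0 < y ord0 j -> 0 < x ord0 j.
  by exists x => // y j; apply: xP; rewrite mem_enum.
elim: (enum 'I_d) => [|i s [x Kx xP]]; first by exists x0.
have [[z [Kz zi]]|noz] := pselect (exists z : 'rV[R]_d, K z /\ 0 < z ord0 i).
  exists (2^-1 *: (x + z)); first exact: midpoint_mem.
  move=> y j /[!inE] /predU1P[->|js] Ky yj; rewrite !mxE.
    by have := K_nonneg _ Kx i; lra.
  by have := K_nonneg _ Kz j; have := xP _ _ js Ky yj; lra.
exists x => // y j /[!inE] /predU1P[->|js] Ky yj; last exact: xP Ky yj.
by case: noz; exists y.
Qed.

Lemma exists_balanced_point : compact K -> K !=set0 ->
  exists2 phi, K phi & forall theta : 'rV[R]_d, K theta ->
    (forall j, phi ord0 j = 0 -> theta ord0 j = 0) /\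
    \prod_j (1 + theta ord0 j / phi ord0 j) <= 2 ^+ d.
Proof.
move=> Kc K0; have [x Kx xP] := exists_common_positive K0.
(* These are exactly the coordinates that do not vanish identically on [K]; hence [F x], and so the
   maximum of [F], is positive. *)
pose F (y : 'rV[R]_d) := \prod_(j | 0 < x ord0 j) y ord0 j.
have cF : continuous F.
  apply: continuous_big => [|j _]; last exact: coord_continuous.
  exact: mul_continuous.
have [phi /set_mem Kphi phimax] :
    exists2 phi, phi \in K & forall t, t \in K -> F t <= F phi.
  by apply: EVT_max_rV => //; exact: continuous_subspaceT.
have Fphi : 0 < F phi.
  by apply: lt_le_trans (phimax x (mem_set Kx)); exact: prodr_gt0.
have phi_gt0 j : 0 < x ord0 j -> 0 < phi ord0 j.
  move=> xj; rewrite lt_def K_nonneg // andbT; apply: contraTneq Fphi => pj.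
  by rewrite /F (bigD1 j) //= pj mul0r ltxx.
have out (y : 'rV[R]_d) j : K y -> ~~ (0 < x ord0 j) -> y ord0 j = 0.
  move=> Ky xj; apply/eqP; rewrite eq_le K_nonneg // andbT leNgt.
  by apply: contra xj; exact: xP.
exists phi => // theta Kt; split=> [j pj|].
  by apply: out => //; apply/negP => /phi_gt0; rewrite pj ltxx.
have := phimax _ (mem_set (midpoint_mem K_convex Kphi Kt)).
rewrite (bigID (fun j => 0 < x ord0 j)) /=.
rewrite [X in _ * X]big1 => [|j xj]; last first.
  by rewrite (out theta) // mul0r addr0.
rewrite mulr1 => le_mid.
have mid : F (2^-1 *: (phi + theta)) = F phi *
    \prod_(j | 0 < x ord0 j) (2^-1 * (1 + theta ord0 j / phi ord0 j)).
  rewrite -big_split; apply: eq_bigr => j /phi_gt0 pj /=; rewrite !mxE.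
  by field; exact: lt0r_neq0.
(* Cancelling [F phi] bounds the product by 2 to the number of coordinates positive at [x], which is
   at most [d]. *)
move: le_mid; rewrite mid ger_pMr // big_split /= prodr_const exprVn.
rewrite mulrC ler_pdivrMr ?exprn_gt0 // mul1r => /le_trans; apply.
by rewrite ler_eXn2l ?ltr1n // (leq_trans (max_card _)) ?card_ord.
Qed.

End NonnegativeConvex.

Lemma sum_floor_log2_le {R : realType} {d : nat} (r : 'I_d -> R) :
  (forall j, 0 <= r j) -> \prod_j (1 + r j) <= 2 ^+ d ->
  (\sum_j floor_log2 (1 + r j) <= d)%N.
Proof.
move=> r0 rd; rewrite -(ler_eXn2l (x := 2 : R)) ?ltr1n //.
apply: le_trans rd; rewrite expr_sum; apply: ler_prod => j _.
have /floor_log2_bounds/andP[le_r _] : 1 <= 1 + r j by rewrite lerDl.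
by rewrite exprn_ge0.
Qed.

(** The coefficient is one term of the binomial expansion of (1 + 1)^n. *)
Lemma bin_le_exp2 n m : ('C(n, m) <= 2 ^ n)%N.
Proof.
have [mn|nm] := leqP m n; last by rewrite bin_small.
have := Pascal 1 1 n; rewrite addn1 => ->.
rewrite (bigD1 (Ordinal (mn : (m < n.+1)%N))) //= !exp1n !muln1.
exact: leq_addr.
Qed.

Lemma exists_four_ratio_cover {R : realType} {d : nat} {K : set 'rV[R]_d}
    (K_nonneg : K `<=` nonneg_orthant R d)
    (K_convex : convex_set (K : set (convex_lmodType 'rV[R]_d)))
    (K_compact : compact K) :
  exists2 A : set 'rV[R]_d, A #<= `I_(2 ^ (2 * d))%N & ratio_cover 4%:R K A.
Proof.
have [->|/set0P K0] := eqVneq K set0.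
  by exists set0; [exact: card_ge0|split].
have [phi Kphi phiP] := exists_balanced_point K_nonneg K_convex K_compact K0.
pose r (theta : 'rV[R]_d) j := theta ord0 j / phi ord0 j.
have r0 theta j : K theta -> 0 <= r theta j.
  by move=> Kt; rewrite divr_ge0 ?K_nonneg.
(* Where [phi] vanishes so does [theta], so the identity survives the division by zero. *)
have rE theta j : K theta -> theta ord0 j = phi ord0 j * r theta j.
  move=> Kt; have [p0|pn0] := eqVneq (phi ord0 j) 0.
    by rewrite p0 mul0r; exact: (phiP _ Kt).1.
  by rewrite mulrC divfK.
pose k theta j := floor_log2 (1 + r theta j).
have sumk theta : K theta -> (\sum_j k theta j <= d)%N.
  move=> Kt; apply: sum_floor_log2_le (phiP _ Kt).2 => j; exact: r0.
have kd theta j : K theta -> (k theta j < d.+1)%N.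
  move=> Kt; rewrite ltnS (leq_trans _ (sumk _ Kt)) //.
  by rewrite (bigD1 j) //= leq_addr.
(* On [K] each [k theta j] is at most [d], so [inord] preserves its value. *)
pose cls theta : d.-tuple 'I_d.+1 := [tuple inord (k theta j) | j < d].
pose S := [set t : d.-tuple 'I_d.+1 | (\sum_(i <- t) i <= d)%N]%SET.
have clsS theta : K theta -> cls theta \in S.
  move=> Kt; rewrite inE big_tuple; apply: leq_trans (sumk _ Kt).
  by apply: leq_sum => j _; rewrite tnth_mktuple inordK // kd.
(* The default [phi] puts [rep t] in [K] even when no point has class [t]. *)
pose rep t := xget phi [set theta | K theta /\ cls theta = t].
have Krep t : K (rep t) by rewrite /rep; case: xgetP => [_ -> []|].
pose t0 := cls phi.
pose g i := 2^-1 *: (phi + rep (nth t0 (enum S) i)).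
exists (g @` `I_#|S|).
  apply: card_le_trans (card_image_le _ _) _; rewrite card_le_II.
  (* The tuples in [S] number 'C(2d, d). *)
  by rewrite card_partial_ord_partitions addnn -mul2n bin_le_exp2.
split=> [_ [i _ <-]|theta Kt]; first exact: midpoint_mem.
exists (g (index (cls theta) (enum S))).
  exists (index (cls theta) (enum S)) => //=.
  by rewrite cardE index_mem mem_enum clsS.
move=> j; rewrite /g nth_index ?mem_enum ?clsS //.
have [Kt' /(congr1 (fun t => nat_of_ord (tnth t j)))] :
    K (rep (cls theta)) /\ cls (rep (cls theta)) = cls theta.
  by apply: (@xgetPex _ phi (fun y => K y /\ cls y = cls theta)); exists theta.
move: (rep _) Kt' => theta' Kt'; rewrite !tnth_mktuple !inordK ?kd // => kE.
have ge1 y : K y -> 1 <= 1 + r y j by move=> Ky; rewrite lerDl r0.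
have /andP[_ lt_r] := floor_log2_bounds (ge1 _ Kt).
have /andP[le_r _] := floor_log2_bounds (ge1 _ Kt').
(* With the common value k of both points, 1 + r theta j < 2 * 2^k <= 2 * (1 + r theta' j). *)
rewrite -/(k _ _) exprS -kE in lt_r.
have lerr : r theta j <= 2 * r theta' j + 1 by rewrite -/(k _ _) in le_r; lra.
have p0 := K_nonneg _ Kphi j.
(* Multiplying by [phi ord0 j] gives theta_j <= 2 theta'_j + phi_j, at most 2 (phi_j + theta'_j),
   which is 4 times the midpoint. *)
have := ler_wpM2l p0 lerr.
rewrite mulrDr mulr1 -rE // mulrCA -rE // !mxE; have := K_nonneg _ Kt' j; lra.
Qed.

Theorem theorem3 (R : realType) (d : nat) (hd : (1 <= d)%N)
    (K : set 'rV[R]_d)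
    (K_nonneg : K `<=` nonneg_orthant R d)
    (K_convex : convex_set (K : set (convex_lmodType 'rV[R]_d)))
    (K_compact : compact K) :
  exists A : set 'rV[R]_d,
    [/\ A `<=` K, A #<= `I_(2 ^ (8 * d))%N & ratio_cover 32%:R K A].
Proof.
have [A Acard [AK Acov]] := exists_four_ratio_cover K_nonneg K_convex K_compact.
exists A; split=> //; last split=> // theta /Acov[phi Aphi le4].
  apply: card_le_trans Acard _.
  by rewrite card_le_II leq_exp2l // leq_mul2r orbT.
exists phi => // j; apply: le_trans (le4 j) _.
by rewrite ler_wpM2r ?ler_nat // K_nonneg //; exact: AK.
Qed.
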